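(* Let $\kappa$ be a positive integer and let $a,u$ be real numbers with $a>-1$ and $u>0$. Then for every integer $n\ge 0$ and every $x\in\mathbb{R}$, with $N$ ranging over the positive integers, $$\lim_{N\to\infty}h_n^{a,\;\kappa+\frac{2^{a+\kappa}}{uN^{\kappa}},\;N;\,\kappa}\!\left(\frac{(1-x)N}{2}\right)=P_n^{a,\kappa;u}(x),$$ where $h_n^{a,b,N;\kappa}$ (taken with $b=\kappa+2^{a+\kappa}/(uN^\kappa)$) are the Krall Hahn polynomials and $P_n^{a,\kappa;u}$ the Krall Jacobi polynomials, both defined in the context.
   Context: $(y)_j=y(y+1)\cdots(y+j-1)$ is the Pochhammer symbol; binomials with real upper entry are generalized. Jacobi polynomials: $P_n^{\alpha,\beta}(x)=2^{-n}\sum_{j=0}^n\binom{n+\alpha}{j}\binom{n+\beta}{n-j}(x-1)^{n-j}(x+1)^j$. Hahn polynomials: for $N\ge n$ a positive integer, $h_n^{a,b,N}(x)=\frac{(a+1)_n}{n!}\,{}_3F_2\!\left(-n,-x,n+a+b+1;\,a+1,-N;\,1\right)=\frac1{n!}\sum_{j=0}^n\frac{(-n)_j(-x)_j(n+a+b+1)_j(a+j+1)_{n-j}}{(-N)_j\,j!}$. For real $w$: $\lambda_j^{w}(x)=\prod_{i=0}^{j-1}(x-i(w+i+1))$ and $\theta_x^{w}=x(x+w+1)$. Dual Hahn polynomials, for real parameters $A,B,M$: $R_n^{A,B,M}(x)=\sum_{j=0}^n\frac{(-n)_j(-M+j)_{n-j}(A+j+1)_{n-j}}{(-1)^j j!}\lambda_j^{A+B}(x)$.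 Krall Hahn polynomials: for positive integers $\kappa$, $N$ and real $a>-1$, $b>\kappa$, set $h_0^{a,b,N;\kappa}=1$ and for $1\le n\le N$ $$h_n^{a,b,N;\kappa}(x)=h_n^{a,b,N}(x)+\frac{(n+a)\,R_\kappa^{-b,-a,a+b+N}(\theta_{-n-1}^{-a-b})}{(n+a+b)\,R_\kappa^{-b,-a,a+b+N}(\theta_{-n}^{-a-b})}\,h_{n-1}^{a,b,N}(x)$$ (the denominators do not vanish, and these polynomials are orthogonal with respect to $\sum_{x=0}^N (N+b-\kappa+1-x)_\kappa\binom{a+x}{x}\binom{N+b-\kappa-1-x}{N-x}\delta_x$). Krall Jacobi polynomials: for a positive integer $\kappa$, $\alpha>-1$ and $u>0$, $P_0^{\alpha,\kappa;u}=1$ and for $n\ge1$ $$P_n^{\alpha,\kappa;u}(x)=P_n^{\alpha,\kappa}(x)+\frac{(n+\alpha)\left[2^{\alpha+\kappa}\Gamma(\kappa)+u(n+1)_\kappa(n+\alpha+1)_\kappa\right]}{(n+\alpha+\kappa)\left[2^{\alpha+\kappa}\Gamma(\kappa)+u(n)_\kappa(n+\alpha)_\kappa\right]}P_{n-1}^{\alpha,\kappa}(x)$$ (these are orthogonal with respect to $(1-x)^\alpha(1+x)^{\kappa-1}dx+\kappa!\,u\,\delta_{-1}$ on $[-1,1]$). *)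

(* Defs.v *)
From mathcomp Require Import all_boot all_order all_algebra.
From mathcomp Require Import all_classical all_reals all_analysis.

Set Implicit Arguments.
Unset Strict Implicit.
Unset Printing Implicit Defensive.

Import Order.TTheory GRing.Theory Num.Theory.
Import numFieldNormedType.Exports.

Local Open Scope classical_set_scope.
Local Open Scope ring_scope.

Definition pochhammer (R : realType) (y : R) (j : nat) : R :=
  \prod_(i < j) (y + i%:R).

Definition gbinom (R : realType) (y : R) (j : nat) : R :=
  (\prod_(i < j) (y - i%:R)) / (j`!)%:R.

(* Euler's integral; the integral converges exactly for 0 < z. *)
Definition Gamma (R : realType) (z : R) : R :=
  Rintegral (@lebesgue_measure R) `]0, +oo[
    (fun t : R => t `^ (z - 1) * expR (- t)).

Definition jacobi (R : realType) (alpha beta : R) (n : nat) (x : R) : R :=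
  2 ^- n * \sum_(j < n.+1)
    gbinom (n%:R + alpha) j * gbinom (n%:R + beta) (n - j) *
    (x - 1) ^+ (n - j) * (x + 1) ^+ j.

(* Expanded form of (a+1)_n / n! * 3F2 (-n, -x, n+a+b+1; a+1, -N; 1). It is
   meaningful for n <= N only: otherwise (-N)_j = 0 for some j <= n. *)
Definition hahn (R : realType) (a b : R) (N n : nat) (x : R) : R :=
  (n`!)%:R^-1 * \sum_(j < n.+1)
    pochhammer (- n%:R) j * pochhammer (- x) j *
    pochhammer (n%:R + a + b + 1) j * pochhammer (a + j%:R + 1) (n - j) /
    (pochhammer (- N%:R) j * (j`!)%:R).

Definition lambda (R : realType) (w : R) (j : nat) (x : R) : R :=
  \prod_(i < j) (x - i%:R * (w + i%:R + 1)).

Definition theta (R : realType) (w x : R) : R := x * (x + w + 1).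

Definition dual_hahn (R : realType) (A B M : R) (n : nat) (x : R) : R :=
  \sum_(j < n.+1)
    pochhammer (- n%:R) j * pochhammer (- M + j%:R) (n - j) *
    pochhammer (A + j%:R + 1) (n - j) / ((-1) ^+ j * (j`!)%:R) *
    lambda (A + B) j x.

(* Intended for 0 < kappa, -1 < a, kappa < b and n <= N. *)
Definition krall_hahn (R : realType) (a b : R) (N kappa n : nat) (x : R) : R :=
  if n == 0%N then 1 else
  let Rk (t : R) := dual_hahn (- b) (- a) (a + b + N%:R) kappa t in
  hahn a b N n x +
  ((n%:R + a) * Rk (theta (- a - b) (- n%:R - 1))) /
  ((n%:R + a + b) * Rk (theta (- a - b) (- n%:R))) *
  hahn a b N n.-1 x.

Definition krall_jacobi (R : realType) (alpha : R) (kappa : nat) (u : R)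
    (n : nat) (x : R) : R :=
  if n == 0%N then 1 else
  let k : R := kappa%:R in
  let D (m : nat) : R :=
    2 `^ (alpha + k) * Gamma k +
    u * pochhammer m%:R kappa * pochhammer (m%:R + alpha) kappa in
  jacobi alpha k n x +
  ((n%:R + alpha) * D n.+1) / ((n%:R + alpha + k) * D n) *
  jacobi alpha k n.-1 x.

(* Main.v *)
(* As [N] tends to infinity, [(x N)_j / (-N)_j] tends to [(-x)^j], so the Hahn
   polynomials tend to the hypergeometric form of the Jacobi polynomials, which
   the Chu-Vandermonde identity rewrites as the symmetric double-binomial form.
   In the dual Hahn sum [R_kappa] only the extreme terms survive: since
   [kappa - b = - c / N^kappa], the term [j = 0] tends to [c (kappa - 1)!] and the
   terms [0 < j < kappa] vanish like [N^-j], while the term [j = kappa] is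
   [lambda_kappa(theta_{-m}) = (m)_kappa (m + a)_kappa] in the limit. *)
Require Import Defs.
From mathcomp Require Import all_boot all_order all_algebra.
From mathcomp Require Import all_classical all_reals all_analysis.
From mathcomp Require Import measurable_realfun ring lra.

Import Order.TTheory GRing.Theory Num.Theory.
Import numFieldNormedType.Exports.

Local Open Scope classical_set_scope.
Local Open Scope ring_scope.

(** * Pochhammer symbols and generalized binomials *)

Section Algebra.
Context {R : realType}.
Implicit Types (y z a b : R) (i j k m n : nat).

Lemma fact_neq0 j : (j`!)%:R != 0 :> R.
Proof. by rewrite pnatr_eq0 -lt0n fact_gt0. Qed.

Lemma pochhammer0 y : pochhammer y 0 = 1.
Proof. by rewrite /pochhammer big_ord0. Qed.

Lemma pochhammerSr y j : pochhammer y j.+1 = pochhammer y j * (y + j%:R).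
Proof. by rewrite /pochhammer big_ord_recr. Qed.

Lemma pochhammer_gt0 y j : 0 < y -> 0 < pochhammer y j.
Proof. by move=> y0; apply: prodr_gt0 => i _; rewrite ltr_wpDr. Qed.

Lemma gbinom0 y : gbinom y 0 = 1.
Proof. by rewrite /gbinom big_ord0 divr1. Qed.

Lemma gbinomS y j : j.+1%:R * gbinom y j.+1 = (y - j%:R) * gbinom y j.
Proof.
rewrite /gbinom big_ord_recr factS natrM /=.
have := fact_neq0 j; have : j.+1%:R != 0 :> R by rewrite pnatr_eq0.
move: (j`!%:R) (j.+1%:R) (\prod_(i < j) _) (y - j%:R) => f c P d c0 f0.
by field; rewrite f0 c0.
Qed.

(** Read backwards, the rising product from [y] is the falling product from [y + j - 1]. *)
Lemma pochhammer_gbinom y j :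
  pochhammer y j = (j`!)%:R * gbinom (y + j%:R - 1) j.
Proof.
rewrite /gbinom mulrC divfK ?fact_neq0// /pochhammer.
rewrite (reindex_inj rev_ord_inj)/=; apply: eq_bigr => i _.
by rewrite natrB ?ltn_ord// -addn1 natrD; ring.
Qed.

Lemma pochhammer_oppn n j : (j <= n)%N ->
  pochhammer (- n%:R : R) j = (-1) ^+ j * (n`!)%:R / ((n - j)`!)%:R.
Proof.
elim: j => [_|j IHj jn].
  by rewrite pochhammer0 subn0 mul1r divff ?fact_neq0.
rewrite pochhammerSr IHj ?(ltnW jn)// -(subnSK jn) factS natrM subnSK//.
have nj0 : (n - j)%:R != 0 :> R by rewrite pnatr_eq0 subn_eq0 -ltnNge.
have := fact_neq0 (n - j.+1); move: nj0; rewrite exprS natrB ?(ltnW jn)//.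
by move: (_`!%:R) (n - j.+1)`!%:R => f g nj0 g0; field; rewrite g0.
Qed.

(** Both sides are the falling product of length [p + q] from [y], divided by [p! q!]. *)
Lemma gbinomD y p q :
  gbinom y (p + q) * ('C(p + q, q))%:R = gbinom y p * gbinom (y - p%:R) q.
Proof.
rewrite /gbinom big_split_ord/=.
have -> : \prod_(i < q) (y - (p + i)%:R) = \prod_(i < q) (y - p%:R - i%:R).
  by apply: eq_bigr => i _; rewrite natrD; ring.
have := bin_fact (leq_addl p q); rewrite addnK => /(congr1 (fun n => n%:R : R)).
rewrite !natrM => <-.
have := fact_neq0 p; have := fact_neq0 q.
have : ('C(p + q, q))%:R != 0 :> R by rewrite pnatr_eq0 -lt0n bin_gt0 leq_addl.
move: (p`!%:R) (q`!%:R) => f g C0 g0 f0; field.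
by rewrite f0 g0.
Qed.

(* Both sides satisfy the recurrence [(m + 1) S (m + 1) = (y + z - m) S m]. *)
Lemma gbinom_Vandermonde y z m :
  \sum_(s < m.+1) gbinom y (m - s) * gbinom z s = gbinom (y + z) m.
Proof.
elim: m => [|m IHm]; first by rewrite big_ord1 !gbinom0 mulr1.
have m0 : m.+1%:R != 0 :> R by rewrite pnatr_eq0.
apply: (mulfI m0); rewrite gbinomS -IHm.
(* Splitting the weight as [m + 1 = (m + 1 - s) + s] lets [gbinomS] act on one factor in each sum.
   The term [s = m + 1] of the first and [s = 0] of the second vanish, so both reduce to sums over
   [s <= m]. *)
have E : m.+1%:R * \sum_(s < m.+2) gbinom y (m.+1 - s) * gbinom z s =
  \sum_(s < m.+2) (m.+1 - s)%:R * gbinom y (m.+1 - s) * gbinom z s +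
  \sum_(s < m.+2) gbinom y (m.+1 - s) * (s%:R * gbinom z s).
  rewrite mulr_sumr -big_split/=; apply: eq_bigr => s _.
  have sm : (s <= m.+1)%N by rewrite -ltnS.
  rewrite (natrB _ sm).
  by move: (gbinom _ _) (gbinom _ _) m.+1%:R s%:R => f g p q; ring.
rewrite E big_ord_recr/= subnn !mul0r addr0.
rewrite [X in _ + X]big_ord_recl/= mul0r mulr0 add0r.
rewrite -big_split mulr_sumr/=; apply: eq_bigr => s _.
have sm : (s <= m)%N by rewrite -ltnS.
rewrite /bump/= add1n subSn// gbinomS gbinomS subSS natrB//.
by move: (gbinom _ _) (gbinom _ _) m%:R s%:R => f g p q; ring.
Qed.

(** * Hypergeometric form of the Jacobi polynomials *)

Lemma exprMD1_widen z s n : (s <= n)%N ->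
  z ^+ s * (1 + z) ^+ (n - s) =
  \sum_(m < n.+1 | (s <= m)%N) ('C(n - s, m - s))%:R * z ^+ m.
Proof.
move=> sn; rewrite exprDn mulr_sumr.
rewrite -(big_geq_mkord s n.+1 xpredT
  (fun m : nat => ('C(n - s, m - s))%:R * z ^+ m)).
rewrite -[X in \big[_/_]_(X <= _ < _) _](add0n s) big_addn subSn//.
rewrite big_mkord; apply: eq_bigr => i _.
by rewrite expr1n mul1r addnK addnC exprD -mulr_natl; ring.
Qed.

(** With [z = (x - 1) / 2], one has [(x + 1) / 2 = 1 + z]. Expanding the powers of [1 + z] and
    exchanging the sums, [gbinomD] pulls [gbinom (n + a) (n - m)] out of the coefficient of [z ^ m];
    what remains is a Vandermonde sum with upper entries [m + a] and [n + b]. *)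
Lemma jacobi_expansion a b n x : jacobi a b n x =
  \sum_(m < n.+1) gbinom (n%:R + a) (n - m) *
    gbinom (n%:R + m%:R + a + b) m * ((x - 1) / 2) ^+ m.
Proof.
set z := (x - 1) / 2.
have -> : jacobi a b n x = \sum_(s < n.+1) \sum_(m < n.+1 | (s <= m)%N)
    gbinom (n%:R + a) (n - s) * gbinom (n%:R + b) s *
    ('C(n - s, m - s)%:R * z ^+ m).
  rewrite /jacobi mulr_sumr (reindex_inj rev_ord_inj)/=; apply: eq_bigr => s _.
  have sn : (s <= n)%N by rewrite -ltnS.
  rewrite -mulr_sumr -exprMD1_widen// subSS subKn//.
  have -> : 1 + z = (x + 1) / 2 by rewrite /z; field.
  rewrite /z !expr_div_n -{1}(subnKC sn) exprD invfM; ring.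
rewrite (exchange_big_dep xpredT)//=; apply: eq_bigr => m _.
have mn : (m <= n)%N by rewrite -ltnS.
have -> : gbinom (n%:R + m%:R + a + b) m =
    gbinom ((m%:R + a) + (n%:R + b)) m by congr gbinom; ring.
rewrite -(gbinom_Vandermonde (m%:R + a)) mulr_sumr mulr_suml.
rewrite (big_ord_widen n.+1 (fun s : nat =>
   gbinom (n%:R + a) (n - m) * (gbinom (m%:R + a) (m - s) * gbinom (n%:R + b) s)
   * z ^+ m))//.
apply: eq_bigr => s sm.
have {}sm : (s <= m)%N by [].
have := gbinomD (n%:R + a) (n - m) (m - s).
have -> : (n - m + (m - s) = n - s)%N by rewrite addnBA// subnK.
have -> : n%:R + a - (n - m)%:R = m%:R + a by rewrite natrB//; ring.
move=> E; transitivity ((gbinom (n%:R + a) (n - s) * ('C(n - s, m - s))%:R) *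
  gbinom (n%:R + b) s * z ^+ m); first by ring.
by rewrite E; ring.
Qed.

(** The sign of [(-n)_j] turns the powers of [(x - 1) / 2] into powers of [(1 - x) / 2]; the rest is
    a termwise comparison. *)
Lemma jacobi_hypergeometric a b n x : jacobi a b n x =
  (n`!)%:R^-1 * \sum_(j < n.+1)
    pochhammer (- n%:R) j * pochhammer (n%:R + a + b + 1) j *
    pochhammer (a + j%:R + 1) (n - j) / (j`!)%:R * ((1 - x) / 2) ^+ j.
Proof.
rewrite jacobi_expansion mulr_sumr; apply: eq_bigr => j _.
have jn : (j <= n)%N by rewrite -ltnS.
rewrite pochhammer_oppn// !pochhammer_gbinom.
have -> : n%:R + a + b + 1 + j%:R - 1 = n%:R + j%:R + a + b by ring.
have -> : a + j%:R + 1 + (n - j)%:R - 1 = n%:R + a by rewrite natrB//; ring.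
have -> : (x - 1) / 2 = (-1) * ((1 - x) / 2) by ring.
rewrite exprMn.
have := fact_neq0 n; have := fact_neq0 j; have := fact_neq0 (n - j).
move: (n`!%:R) (j`!%:R) ((n - j)`!%:R) => f g h h0 g0 f0; field.
by rewrite f0 g0 h0.
Qed.

(** * Factorization of [lambda] on the quadratic lattice [theta] *)

Lemma lambda_theta w j y : lambda w j (theta w y) =
  \prod_(i < j) ((y - i%:R) * (y + i%:R + w + 1)).
Proof. by rewrite /lambda /theta; apply: eq_bigr => i _; ring. Qed.

(** The [i]-th factor is [(-m - i) (-m - a - (k - 1 - i))]: its two signs cancel, and reversing the
    second product yields a rising one. *)
Lemma lambda_theta_oppn a k m :
  lambda (- a - k%:R) k (theta (- a - k%:R) (- m%:R)) =
  pochhammer m%:R k * pochhammer (m%:R + a) k.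
Proof.
rewrite lambda_theta big_split/= [X in _ * X](reindex_inj rev_ord_inj)/=.
rewrite /pochhammer -!big_split/=; apply: eq_bigr => i _.
by rewrite natrB ?ltn_ord// -addn1 natrD; ring.
Qed.

End Algebra.

(** * The Gamma function at positive integers *)

Section GammaNat.
Context {R : realType}.

(** The bound [expR t >= t ^ (k + 1) / (k + 1)!] squeezes the product between [0] and
    [(k + 1)! / t]. *)
Lemma cvg_exprn_expRN k : (t : R) ^+ k * expR (- t) @[t --> +oo] --> 0.
Proof.
apply: (@squeeze_cvgr _ _ _ _ (fun=> 0) (fun t => (k.+1)`!%:R / t)).
- near=> t; have t0 : 0 < t by [].
  rewrite mulr_ge0 ?expR_ge0 ?exprn_ge0 ?(ltW t0)//=.
  rewrite expRN ler_pdivlMr// mulrAC -exprSr ler_pdivrMr ?expR_gt0//.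
  rewrite mulrC -ler_pdivrMr ?ltr0n ?fact_gt0//.
  by apply: le_trans (expR_ge1Dxn k (ltW t0)); rewrite lerDr.
- exact: cvg_cst.
- rewrite -[0](mulr0 (k.+1)`!%:R); apply: cvgMl_tmp.
  by apply/gtr0_cvgV0; [near=> t|exact: cvg_id].
Unshelve. all: by end_near.
Qed.

(** Integration by parts at the level of primitives: [- t ^ (k + 1) * expR (- t) + (k + 1) * F t] is
    the next primitive, so the limit at infinity and the value at [0] follow by induction. *)
Lemma exprn_expRN_primitive k : exists F : R -> R,
  [/\ forall t : R, is_derive t (1 : R) F (t ^+ k * expR (- t)),
      F t @[t --> +oo] --> 0 & F 0 = - (k`!)%:R].
Proof.
elim: k => [|k [F [dF Foo F0]]].
- exists (fun t => - expR (- t)); split.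
  + move=> t; apply: is_derive_eq.
    by rewrite expr0 /GRing.scale/=; ring.
  + by rewrite -oppr0; apply: cvgN; exact: cvgr_expR.
  + by rewrite oppr0 expR0.
- exists (fun t => - (t ^+ k.+1 * expR (- t)) + k.+1%:R * F t); split.
  + move=> t; have dFt := dF t.
    have dX : is_derive t (1 : R) (fun t => t ^+ k.+1) (k.+1%:R * t ^+ k).
      rewrite (_ : (fun s : R => _) = (@id R) ^+ k.+1); last first.
        by apply/funext => s; rewrite exprfctE.
      by apply: is_derive_eq; rewrite /GRing.scale/= mulr1.
    have dE : is_derive t (1 : R) (fun t => expR (- t)) (- expR (- t)).
      by apply: is_derive_eq; rewrite /GRing.scale/= mulrN1.
    have dP := is_deriveM dX dE.
    have dQ : is_derive t (1 : R) (fun t => k.+1%:R * F t) _ :=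
      is_deriveZ k.+1%:R dFt.
    apply: is_derive_eq (is_deriveD (is_deriveN dP) dQ) _.
    rewrite /GRing.scale/= !exprS; ring.
  + rewrite (_ : 0 = - 0 + k.+1%:R * 0 :> R); last by rewrite oppr0 mulr0 addr0.
    by apply: cvgD; [apply: cvgN; exact: cvg_exprn_expRN|exact: cvgMl_tmp].
  + by rewrite exprS !mul0r F0 factS natrM; ring.
Qed.

Lemma GammaS k : Gamma (k.+1%:R : R) = (k`!)%:R.
Proof.
have [F [dF Foo F0]] := exprn_expRN_primitive k.
pose f (t : R) := t ^+ k * expR (- t).
have cf : continuous f.
  move=> t; apply: cvgM; first exact: exprn_continuous.
  apply: continuous_comp; first exact: opp_continuous.
  exact: continuous_expR.
transitivity (Rintegral (@lebesgue_measure R) `[0, +oo[ f).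
  (* The endpoint [0] is negligible for the integral. The real power in [Gamma] is compared with
     [t ^ k] only for [t > 0], while the fundamental theorem of calculus needs the closed
     half-line. *)
  rewrite /Rintegral -integral_itv_obnd_cbnd; last first.
    apply/measurable_EFinP; apply: measurable_funTS.
    exact: continuous_measurable_fun.
  apply: eq_Rintegral => t; rewrite inE/= in_itv/= andbT => t0.
  by rewrite -natr1 addrK powR_mulrn// ltW.
rewrite (@Rintegral_ge0_continuous_FTC2y _ f F 0 0)//.
- by rewrite F0 sub0r opprK.
- by move=> t t0; rewrite mulr_ge0 ?expR_ge0 ?exprn_ge0.
- exact: continuous_subspaceT.
- by apply: cvg_at_right_filter; apply: differentiable_continuous;
  apply/derivable1_diffP.
- by move=> t _; rewrite derive1E derive_val.
Qed.
End GammaNat.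

(** * Limits of Pochhammer symbols, Hahn and dual Hahn polynomials *)

Section Limits.
Context {R : realType}.
Implicit Types (a b c l : R) (f g : nat -> R).

Lemma cvg_prodr (k : nat) (f : 'I_k -> nat -> R) (l : 'I_k -> R) :
  (forall i, f i N @[N --> \oo] --> l i) ->
  \prod_(i < k) f i N @[N --> \oo] --> \prod_(i < k) l i.
Proof. by move=> fl; apply: cvg_big => //; exact: mul_continuous. Qed.

Lemma cvg_sumr (k : nat) (f : 'I_k -> nat -> R) (l : 'I_k -> R) :
  (forall i, f i N @[N --> \oo] --> l i) ->
  \sum_(i < k) f i N @[N --> \oo] --> \sum_(i < k) l i.
Proof. by move=> fl; apply: cvg_big => //; exact: add_continuous. Qed.

Lemma cvg_exprn f l k : f N @[N --> \oo] --> l ->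
  f N ^+ k @[N --> \oo] --> l ^+ k.
Proof.
exact: (continuous_cvg _ (@exprn_continuous R k l)).
Qed.

Lemma cvg_invn : (N%:R : R)^-1 @[N --> \oo] --> 0.
Proof.
apply/gtr0_cvgV0; last exact: cvgr_idn.
by exists 1%N => // N /= N0; rewrite ltr0n.
Qed.

Lemma cvg_add_div_exprn l c k : l + c / N%:R ^+ k.+1 @[N --> \oo] --> l.
Proof.
rewrite -[X in _ --> X]addr0 -(mulr0 c); apply: cvgD; first exact: cvg_cst.
apply: cvgMl_tmp; under eq_fun do rewrite -exprVn.
rewrite (_ : 0 = 0 ^+ k.+1 :> R); last by rewrite expr0n.
by apply: cvg_exprn; exact: cvg_invn.
Qed.

Lemma cvg_pochhammer f l j : f N @[N --> \oo] --> l ->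
  pochhammer (f N) j @[N --> \oo] --> pochhammer l j.
Proof.
by move=> fl; apply: cvg_prodr => i; apply: cvgD => //; exact: cvg_cst.
Qed.

(** Each factor, divided by [N], is [f N / N + i / N], and the shift [i / N] vanishes in the
    limit. *)
Lemma cvg_pochhammer_scaled f l j : f N / N%:R @[N --> \oo] --> l ->
  pochhammer (f N) j / N%:R ^+ j @[N --> \oo] --> l ^+ j.
Proof.
move=> fl; rewrite -[in l ^+ j](card_ord j) -prodr_const.
have -> : (fun N => pochhammer (f N) j / N%:R ^+ j) =
    (fun N => \prod_(i < j) (f N / N%:R + i%:R * N%:R^-1)).
  apply/funext => N; rewrite /pochhammer -exprVn -[in X in _ ^+ X](card_ord j).
  by rewrite -prodr_const -big_split; apply: eq_bigr => i _ /=; rewrite mulrDl.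
apply: cvg_prodr => i; rewrite -[l]addr0 -(mulr0 i%:R).
by apply: cvgD => //; apply: cvgMl_tmp; exact: cvg_invn.
Qed.

Lemma near_natr_neq0 : \forall N \near \oo, (N%:R : R) != 0.
Proof. by exists 1%N => // N /= N0; rewrite pnatr_eq0 -lt0n. Qed.

Lemma cvg_mulnK c : c * N%:R / N%:R @[N --> \oo] --> c.
Proof.
apply: (@cvg_trans _ ((fun=> c) @ \oo)); last exact: cvg_cst.
apply: near_eq_cvg; near=> N; rewrite mulfK//; near: N; exact: near_natr_neq0.
Unshelve. all: by end_near.
Qed.

(** The second parameter varies with [N], as in the theorem. The denominators [(-N)_j] with [j <= n]
    vanish only for [N < n], which does not affect the limit. *)
Lemma cvg_hahn a b f n x : f N @[N --> \oo] --> b ->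
  hahn a (f N) N n ((1 - x) * N%:R / 2) @[N --> \oo] --> jacobi a b n x.
Proof.
move=> fb; rewrite jacobi_hypergeometric; apply: cvgMl_tmp.
apply: cvg_sumr => j.
set p := pochhammer (- n%:R) j; set q := pochhammer (a + j%:R + 1) (n - j).
(* Numerator and denominator are both divided by [N ^ j], which is legitimate once [N] is nonzero;
   their limits are [(- (1 - x) / 2) ^ j] and [(-1) ^ j]. *)
pose F N := (p * pochhammer (n%:R + a + f N + 1) j * q / j`!%:R) *
  ((pochhammer (- ((1 - x) * N%:R / 2)) j / N%:R ^+ j) /
   (pochhammer (- N%:R) j / N%:R ^+ j)).
apply: (@cvg_trans _ (F @ \oo)).
  apply: near_eq_cvg; near=> N.
  have N0 : (N%:R : R) != 0 by near: N; exact: near_natr_neq0.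
  rewrite /F invf_div [X in _ * X]mulrA divfK ?expf_neq0// invfM; ring.
have E : ((1 - x) / 2) ^+ j = (- ((1 - x) / 2)) ^+ j / (-1) ^+ j.
  by rewrite -expr_div_n invrN1 mulrN1 opprK.
rewrite E; apply: cvgM.
  apply: cvgMr_tmp; apply: cvgMr_tmp; apply: cvgMl_tmp; apply: cvg_pochhammer.
  by apply: cvgD; [apply: cvgD => //; exact: cvg_cst|exact: cvg_cst].
apply: cvgM; first apply: cvg_pochhammer_scaled.
  have -> : (fun N => - ((1 - x) * N%:R / 2) / N%:R) =
     (fun N => - ((1 - x) / 2) * N%:R / N%:R) by apply/funext => N; ring.
  exact: cvg_mulnK.
apply: cvgV; first by rewrite expf_neq0// oppr_eq0 oner_eq0.
apply: cvg_pochhammer_scaled.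
have -> : (fun N => - N%:R / N%:R) = (fun N => -1 * N%:R / N%:R :> R).
  by apply/funext => N; rewrite mulN1r.
exact: cvg_mulnK.
Unshelve. all: by end_near.
Qed.

Lemma cvg_dual_hahn k a c y (b := fun N : nat => k.+1%:R + c / N%:R ^+ k.+1) :
  dual_hahn (- b N) (- a) (a + b N + N%:R) k.+1 (theta (- a - b N) y)
    @[N --> \oo] -->
  c * k`!%:R + lambda (- a - k.+1%:R) k.+1 (theta (- a - k.+1%:R) y).
Proof.
have cb : b N @[N --> \oo] --> (k.+1%:R : R) by exact: cvg_add_div_exprn.
(* Here [b N] enters both [lambda] and [theta]; in factored form each factor is affine in it. *)
have cl j : lambda (- b N + - a) j (theta (- a - b N) y) @[N --> \oo] -->
    lambda (- a - k.+1%:R) j (theta (- a - k.+1%:R) y).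
  under eq_fun do rewrite [- b _ + _]addrC lambda_theta.
  rewrite lambda_theta; apply: cvg_prodr => i; apply: cvgMl_tmp.
  apply: cvgD; last exact: cvg_cst; apply: cvgD; first exact: cvg_cst.
  by apply: cvgD; [exact: cvg_cst|exact: cvgN].
(* The termwise limits: only the two extreme indices contribute. *)
pose l (j : 'I_k.+2) := if j == ord0 then c * k`!%:R else
  if j == ord_max then lambda (- a - k.+1%:R) k.+1 (theta (- a - k.+1%:R) y)
  else 0.
have -> : c * k`!%:R + lambda (- a - k.+1%:R) k.+1 (theta (- a - k.+1%:R) y) =
    \sum_(j < k.+2) l j.
  rewrite big_ord_recl (bigD1 ord_max)//= big1 ?addr0.
    by rewrite /l /= (_ : lift _ _ == _)//; apply/eqP/val_inj.
  move=> j jm; rewrite /l /= ifF//; apply: contraNF jm => /eqP/(congr1 val)/=.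
  by rewrite /bump/= add1n => -[E]; apply/eqP/val_inj.
apply: cvg_sumr => j.
have [jk|jk] := eqVneq j ord_max.
  (* In the top term the other two Pochhammer symbols are empty and [(-k-1)_(k+1)] cancels the
     denominator exactly. *)
  have kk := @pochhammer_oppn R _ _ (leqnn k.+1); rewrite subnn divr1 in kk.
  have -> : l j = 1 * lambda (- a - k.+1%:R) k.+1 (theta (- a - k.+1%:R) y).
    by rewrite jk /l eqxx mul1r.
  rewrite jk /=; under eq_fun do rewrite subnn !pochhammer0 !mulr1 kk.
  rewrite divff ?mulf_neq0 ?fact_neq0 ?expf_neq0 ?oppr_eq0 ?oner_eq0//.
  exact: cvgMl_tmp.
have {}jk : (j <= k)%N.
  have := ltn_ord j; rewrite ltnS leq_eqVlt => /orP[/eqP jk1|//].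
  by move/eqP: jk; case; apply: ord_inj; rewrite jk1.
(* The factor [k.+1 - b N = - c / N ^ k.+1] of the last Pochhammer symbol absorbs
   the growth [N ^ (k.+1 - j)] of the other one; the excess is [N ^ - j]. *)
pose p : R := pochhammer (- k.+1%:R) j; pose w : R := (-1) ^+ j * j`!%:R.
pose F N := p *
  (pochhammer (- (a + b N + N%:R) + j%:R) (k.+1 - j) / N%:R ^+ (k.+1 - j)) *
  (pochhammer (- b N + j%:R + 1) (k - j) * (- c * (N%:R^-1) ^+ j)) / w *
  lambda (- b N + - a) j (theta (- a - b N) y).
apply: (@cvg_trans _ (F @ \oo)).
  apply: near_eq_cvg; near=> N.
  have N0 : (N%:R : R) != 0 by near: N; exact: near_natr_neq0.
  rewrite /F -/p -/w; congr (_ / _ * _); rewrite -!mulrA; congr (_ * (_ * _)).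
  rewrite mulrCA subSn// pochhammerSr; congr (_ * _).
  have -> : - b N + j%:R + 1 + (k - j)%:R = - c / N%:R ^+ k.+1.
    by rewrite /b natrB// -natr1; ring.
  rewrite mulrCA; congr (_ * _).
  rewrite -subSn// exprVn -invfM -exprD subnK//; exact: leqW.
(* The factor [0 ^ j], equal to [1] at [j = 0], treats the bottom and middle terms together. At
   [j = 0] the signs [(-1) ^ (k + 1)], [(-1) ^ k] from [(-k)_k], and that of [- c] multiply to
   [1]. *)
have -> : l j = p * (-1) ^+ (k.+1 - j) *
    (pochhammer (- k.+1%:R + j%:R + 1) (k - j) * (- c * 0 ^+ j)) / w *
    lambda (- a - k.+1%:R) j (theta (- a - k.+1%:R) y).
  rewrite /l; have [jE|j0] := eqVneq j ord0; last first.
    have {}j0 : val j != 0%N by apply: contraNneq j0 => E; apply/eqP/val_inj.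
    rewrite -val_eqE/= ltn_eqF ?ltnS//.
    by rewrite expr0n (negbTE j0) !mulr0 !mul0r.
  rewrite /p /w jE /= !subn0 !pochhammer0 /lambda big_ord0 mulr1 expr0 addr0.
  have -> : - k.+1%:R + 1 = - k%:R :> R by rewrite -natr1; ring.
  rewrite pochhammer_oppn// subnn fact0 expr0 mul1r !divr1 exprS.
  have e1 : (-1) ^+ k * (-1) ^+ k = 1 :> R by rewrite -expr2 sqrr_sign.
  transitivity ((-1) ^+ k * (-1) ^+ k * (c * k`!%:R)); first by rewrite e1 mul1r.
  by field.
apply: cvgM; last exact: cl.
apply: cvgMr_tmp; apply: cvgM; last first.
  apply: cvgM; first apply: cvg_pochhammer.
    by apply: cvgD; [apply: cvgD; [exact: cvgN|exact: cvg_cst]|exact: cvg_cst].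
  by apply: cvgMl_tmp; apply: cvg_exprn; exact: cvg_invn.
apply: cvgMl_tmp; apply: cvg_pochhammer_scaled.
have -> : (fun N => (- (a + b N + N%:R) + j%:R) / N%:R) =
    (fun N => (-1 * N%:R / N%:R) + (- (a + b N) + j%:R) * N%:R^-1).
  by apply/funext => N; ring.
rewrite -[X in _ --> X]addr0 -(mulr0 (- (a + k.+1%:R) + j%:R)).
apply: cvgD; first exact: cvg_mulnK.
apply: cvgM; last exact: cvg_invn.
apply: cvgD; last exact: cvg_cst.
by apply: cvgN; apply: cvgD => //; exact: cvg_cst.
Unshelve. all: by end_near.
Qed.

End Limits.

(** * Convergence of the Krall Hahn polynomials *)

Theorem lemma3p2 (R : realType) (kappa : nat) (a u : R)
    (kappa_gt0 : (0 < kappa)%N) (a_gtN1 : -1 < a) (u_gt0 : 0 < u)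
    (n : nat) (x : R) :
  (fun N : nat =>
     krall_hahn a (kappa%:R + 2 `^ (a + kappa%:R) / (u * N%:R ^+ kappa))
       N kappa n ((1 - x) * N%:R / 2))
    @ \oo --> krall_jacobi a kappa u n x.

Proof.
have [->|n_gt0] := posnP n.
  by rewrite /krall_hahn /krall_jacobi eqxx; exact: cvg_cst.
case: kappa kappa_gt0 => [//|k] _.
rewrite /krall_jacobi /krall_hahn gtn_eqF// GammaS.
set P := 2 `^ _; pose c := P / u.
pose b (N : nat) : R := k.+1%:R + c / N%:R ^+ k.+1.
have bE N : k.+1%:R + P / (u * N%:R ^+ k.+1) = b N by rewrite invfM mulrA.
under eq_fun do rewrite bE.
have cb : b N @[N --> \oo] --> (k.+1%:R : R) by exact: cvg_add_div_exprn.
have na_gt0 : 0 < n%:R + a :> R.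
  have : 1 <= n%:R :> R by rewrite ler1n.
  lra.
(* This is the limit of the dual Hahn value at [theta_{-m}], and also the bracket in [krall_jacobi]
   divided by [u]; the factor [u] cancels in the ratio. *)
pose D (m : nat) :=
  c * k`!%:R + pochhammer m%:R k.+1 * pochhammer (m%:R + a) k.+1.
have DE m : P * k`!%:R + u * pochhammer m%:R k.+1 * pochhammer (m%:R + a) k.+1 =
    u * D m.
  by rewrite /D /c; field; rewrite gt_eqF.
(* Positivity, which rests on [n >= 1] and [a > -1], keeps the limit of the denominator nonzero. *)
have D_gt0 : 0 < D n.
  rewrite ltr_wpDr//.
    by rewrite mulr_ge0// ltW// pochhammer_gt0// ltr0n.
  by rewrite mulr_gt0 ?divr_gt0 ?powR_gt0 ?ltr0n ?fact_gt0.
have cR m : dual_hahn (- b N) (- a) (a + b N + N%:R) k.+1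
    (theta (- a - b N) (- m%:R)) @[N --> \oo] --> D m.
  by rewrite /D -lambda_theta_oppn; exact: cvg_dual_hahn.
have n1E : - n%:R - 1 = - n.+1%:R :> R by rewrite -natr1 opprD.
rewrite !DE n1E; apply: cvgD; first exact: cvg_hahn.
apply: cvgM; last exact: cvg_hahn.
have -> : (n%:R + a) * (u * D n.+1) / ((n%:R + a + k.+1%:R) * (u * D n)) =
    (n%:R + a) * D n.+1 / ((n%:R + a + k.+1%:R) * D n).
  rewrite !(mulrCA _ u) -mulf_div divff ?mul1r// gt_eqF//.
apply: cvgM; first by apply: cvgMl_tmp; exact: cR.
apply: cvgV.
  by rewrite mulf_neq0 ?(gt_eqF D_gt0)// gt_eqF// ltr_wpDr.
by apply: cvgM => //; apply: cvgD => //; exact: cvg_cst.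
Qed.
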